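(* Let $d>0$ be an integer, let $N\geq d$ be an integer, and let $c\geq 0$ and $m>0$ be integers. Then $$\operatorname{div}(n,d)=\operatorname{div}(c\cdot n+c,\,m)\quad\text{and}\quad \operatorname{rem}(n,d)=\operatorname{div}(\operatorname{rem}(c\cdot n+c,\,m)\cdot d,\,m)$$ hold for all integers $n\in[0,N]$ if and only if $$\left(1-\frac{1}{N+1}\right)\frac1d\leq \frac cm<\frac1d.$$
   Context: For a non-negative real $x$ and a positive real $y$, define $\operatorname{div}(x,y)=\lfloor x/y\rfloor$ and $\operatorname{rem}(x,y)=x-\lfloor x/y\rfloor\cdot y$, where $\lfloor\cdot\rfloor$ is the floor function. *)

(* Defs.v *)
From mathcomp Require Import all_boot all_order all_algebra.
From mathcomp Require Import reals.

Set Implicit Arguments.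
Unset Strict Implicit.
Unset Printing Implicit Defensive.

Import Order.TTheory GRing.Theory Num.Theory.

Local Open Scope ring_scope.

(* Only meaningful for 0 <= x and 0 < y. *)
Definition rdiv (R : realType) (x y : R) : int := Num.floor (x / y).

Definition rrem (R : realType) (x y : R) : R := x - (Num.floor (x / y))%:~R * y.

(* Main.v *)
(* Both equalities at a given [n] amount to
   [n * m <= c * d * (n + 1) < (n + 1) * m]: once [c * (n + 1) = q * m + s] with
   [n = q * d + r], one has [s * d = c * d * (n + 1) - (n - r) * m], so that
   [r = s * d %/ m] unfolds to exactly these bounds.  The upper bound says
   [c * d < m], and then the lower bound is strongest at [n = N], where the two
   together are the bounds on [c / m]. *)

Require Import Defs.
From mathcomp Require Import all_boot all_order all_algebra.
From mathcomp Require Import reals.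
From mathcomp Require Import zify ring.

Set Implicit Arguments.
Unset Strict Implicit.
Unset Printing Implicit Defensive.

Import Order.TTheory GRing.Theory Num.Theory.

Local Open Scope ring_scope.

Lemma divz_eqP (a b q : int) :
  0 < b -> reflect (q * b <= a < (q + 1) * b) (q == (a %/ b)%Z).
Proof.
move=> b_gt0; rewrite eq_le lez_divRL // -[(a %/ b)%Z <= q]ltzD1 ltz_divLR //.
exact: idP.
Qed.

Lemma rdiv_int (R : realType) (a b : int) :
  0 < b -> rdiv (a%:~R : R) b%:~R = (a %/ b)%Z.
Proof.
move=> b_gt0; apply: floor_def.
rewrite ler_pdivlMr ?ltr0z // ltr_pdivrMr ?ltr0z //.
by rewrite -!intrM ler_int ltr_int lez_floor ?gt_eqF // ltz_ceil.
Qed.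

(** Because this remainder is again an integer, the nested [rdiv] of an [rrem] also falls under
    [rdiv_int], and the whole claim can be settled in [int]. *)
Lemma rrem_int (R : realType) (a b : int) :
  0 < b -> rrem (a%:~R : R) b%:~R = (a %% b)%Z%:~R.
Proof.
move=> b_gt0; rewrite /rrem -/(rdiv _ _) rdiv_int //.
by rewrite -intrM -intrB.
Qed.

Lemma divmod_eqP (d c m n : int) : 0 < d -> 0 < m ->
  ((n %/ d)%Z = ((c * n + c) %/ m)%Z /\
   (n %% d)%Z = (((c * n + c) %% m)%Z * d %/ m)%Z) <->
  n * m <= c * d * (n + 1) < (n + 1) * m.
Proof.
move=> d_gt0 m_gt0.
have n_eq := divz_eq n d.
have r_ge0 := modz_ge0 n (lt0r_neq0 d_gt0).
have r_lt := ltz_pmod n d_gt0.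
set q := (n %/ d)%Z in n_eq *; set r := (n %% d)%Z in n_eq r_ge0 r_lt *.
have bounds_eq : ((c * n + c) %/ m)%Z = q ->
    (r == (((c * n + c) %% m)%Z * d %/ m)%Z) =
    (n * m <= c * d * (n + 1) < (n + 1) * m).
  move=> q_eq; rewrite /modz q_eq (sameP (divz_eqP _ _ m_gt0) idP).
  have -> : (c * n + c - q * m) * d = c * d * (n + 1) - (n - r) * m.
    by rewrite [in n - r]n_eq; ring.
  by rewrite lerBrDr ltrBlDr -!mulrDl subrKC [r + 1 + _]addrAC subrKC.
split=> [[/esym q_eq /eqP]|bnd]; first by rewrite bounds_eq.
(* The bounds alone force equal quotients: [q * d <= n] and, by integrality, [n + 1 <= (q + 1) * d],
   so [c * d * (n + 1)] lies in [[q * d * m, (q + 1) * d * m)]; then cancel [d]. *)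
have q_eq : q = ((c * n + c) %/ m)%Z.
  apply/eqP/divz_eqP => //.
  case/andP: bnd => lo up; apply/andP; split.
    rewrite -(ler_pM2r d_gt0).
    have : q * d * m <= n * m by rewrite ler_pM2r //; lia.
    lia.
  rewrite -(ltr_pM2r d_gt0).
  have : (n + 1) * m <= (q + 1) * d * m by rewrite ler_pM2r //; lia.
  lia.
by split=> //; apply/eqP; rewrite bounds_eq.
Qed.

Theorem theorem4 (R : realType) (d N c m : int)
    (hd : 0 < d) (hN : d <= N) (hc : 0 <= c) (hm : 0 < m) :
  (forall n : int, 0 <= n -> n <= N ->
     rdiv (n%:~R : R) d%:~R = rdiv (c%:~R * n%:~R + c%:~R : R) m%:~R
     /\ rrem (n%:~R : R) d%:~R =
        (rdiv (rrem (c%:~R * n%:~R + c%:~R : R) m%:~R * d%:~R) m%:~R)%:~R)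
  <->
  (1 - 1 / (N%:~R + 1)) * (1 / d%:~R) <= (c%:~R / m%:~R : R)
  /\ (c%:~R / m%:~R : R) < 1 / d%:~R.
Proof.
(* The left end of the interval is [N / ((N + 1) * d)]; clearing denominators gives the integer
   bounds at [n = N], with [c * d < m] scaled by [N + 1]. *)
have ratio_bounds : (1 - 1 / (N%:~R + 1)) * (1 / d%:~R) <= (c%:~R / m%:~R : R)
    /\ (c%:~R / m%:~R : R) < 1 / d%:~R <->
    N * m <= c * d * (N + 1) < (N + 1) * m.
  have N1_gt0 : 0 < N + 1 by lia.
  have -> : (1 - 1 / (N%:~R + 1)) * (1 / d%:~R) =
      N%:~R / ((N + 1) * d)%:~R :> R.
    rewrite intrM intrD; field.
    by rewrite -[1]/(1%:~R) -intrD !intr_eq0 !gt_eqF.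
  rewrite ler_pdivrMr ?ltr0z ?mulr_gt0 // mulrAC ler_pdivlMr ?ltr0z //.
  rewrite ltr_pdivrMr ?ltr0z // mulrAC ltr_pdivlMr ?ltr0z // mul1r.
  rewrite -!intrM ler_int ltr_int.
  by split=> [[]|/andP[]]; nia.
have step n :
    (rdiv (n%:~R : R) d%:~R = rdiv (c%:~R * n%:~R + c%:~R : R) m%:~R
     /\ rrem (n%:~R : R) d%:~R =
        (rdiv (rrem (c%:~R * n%:~R + c%:~R : R) m%:~R * d%:~R) m%:~R)%:~R)
    <-> n * m <= c * d * (n + 1) < (n + 1) * m.
  rewrite -divmod_eqP // -intrM -intrD !rrem_int // -intrM.
  rewrite !rdiv_int //; split=> -[-> rE]; split=> //; last by rewrite rE.
  exact: (intr_inj rE).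
rewrite ratio_bounds; split=> [all_n|bnd n n_ge0 n_le].
  by apply/step/all_n; lia.
apply/step; case/andP: bnd => lo up.
(* The lower bound reads [n * (m - c * d) <= c * d]; as [m - c * d] is positive, it passes from [N]
   to every smaller [n]. The upper one is [c * d < m] times [n + 1]. *)
have cd_lt : c * d < m by nia.
apply/andP; split; nia.
Qed.
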